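(* For any demand distribution $F$ with the DMRD property, the probability $F(r^* )$ of no-trade at the equilibrium of the stochastic market cannot exceed the bound $1-e^{-1}$, i.e. $F(r^* )\le 1-e^{-1}$, where $r^*$ is the supplier's optimal wholesale price. This bound is tight over all DMRD distributions (i.e. $1-e^{-1}$ cannot be replaced by a smaller constant valid for all DMRD distributions).
   Context: A demand distribution is the law of a nonnegative random variable $\alpha$ with continuous (non-atomic) cdf $F$, $F(0)=0$, and finite mean. Let $\bar F:=1-F$ and $H=\inf\{r\ge0:F(r)=1\}\in(0,\infty]$. The mean residual demand (MRD) function is $\mathrm{m}(r):=\mathbb{E}(\alpha-r\mid\alpha>r)=\frac{1}{\bar F(r)}\int_r^\infty\bar F(u)\,du$ for $r<H$ and $\mathrm{m}(r):=0$ otherwise. $F$ has the DMRD property if $\mathrm{m}$ is non-increasing. The supplier's optimal wholesale price $r^*$ is the maximizer of $r\,\mathbb{E}(\alpha-r)_+$ over $r\ge0$, where $(x)_+=\max\{0,x\}$; for a DMRD distribution it exists and is the unique solution of $r=\mathrm{m}(r)$. No trade takes place (retailers order zero) when $\alpha\le r^*$, which has probability $F(r^* )$. *)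

(* Defs.v *)
From HB Require Import structures.
From mathcomp Require Import all_boot all_order all_algebra.
From mathcomp Require Import all_classical all_reals all_analysis.
Import Order.TTheory GRing.Theory Num.Theory.
Import numFieldNormedType.Exports.

Set Implicit Arguments.
Unset Strict Implicit.
Unset Printing Implicit Defensive.

Local Open Scope classical_set_scope.
Local Open Scope ring_scope.

Section Demand.
Context (d : measure_display) (T : measurableType d) (R : realType).
Context (P : probability T R) (alpha : {RV P >-> R}).

Definition demand_cdf (r : R) : R := fine (cdf alpha r).

Definition demand_distribution : Prop :=
  [/\ forall w, 0 <= alpha w,
      continuous demand_cdf,
      demand_cdf 0 = 0 &
      P.-integrable [set: T] (EFin \o alpha)].

(* [H], the upper end of the support; [+oo] if [F] never reaches 1. *)
Definition demand_sup : \bar R :=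
  ereal_inf [set r%:E | r in [set r : R | 0 <= r /\ demand_cdf r = 1]].

(* Elementary conditional expectation given an event; only meaningful when
   [A] has positive probability and [X] is integrable. *)
Definition cond_expectation (X : T -> R) (A : set T) : R :=
  fine (\int[P]_(w in A) (X w)%:E)%E / fine (P A).

(* [m(r)]; for [0 <= r < H] the conditioning event has probability
   [1 - F r > 0]. *)
Definition mrd (r : R) : R :=
  if (r%:E < demand_sup)%E
  then cond_expectation (fun w => alpha w - r) [set w | r < alpha w]
  else 0.

Definition DMRD : Prop := {in `[0, +oo[ &, nonincreasing_fun mrd}.

Definition supplier_profit (r : R) : R :=
  r * fine ('E_P[(fun w => Num.max 0 (alpha w - r))%R])%E.

Definition optimal_price (r : R) : Prop :=
  0 <= r /\ forall s, 0 <= s -> supplier_profit s <= supplier_profit r.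

End Demand.

(* Main.v *)
(** Write [G r = E(alpha - r)_+], so that [G' = F - 1] and [m = G / (1 - F)].
    The first-order condition for [r G(r)] gives [m(r) = r] at the optimum [r].
    DMRD gives [m(s) >= r] on [[0, r]], i.e. [(log G)' = - 1 / m >= - 1 / r]
    there, hence [r (1 - F r) = G r >= e^-1 G 0 = e^-1 m(0) >= e^-1 r].
    Equality holds for the exponential distribution, where [m = 1] and [r = 1]. *)
Require Import Defs.
From HB Require Import structures.
From mathcomp Require Import all_boot all_order all_algebra.
From mathcomp Require Import all_classical all_reals all_analysis.
From mathcomp Require Import measurable_realfun ring lra.
Import Order.TTheory GRing.Theory Num.Theory.
Import numFieldNormedType.Exports.

Set Implicit Arguments.
Unset Strict Implicit.

Local Open Scope classical_set_scope.
Local Open Scope ring_scope.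

(* The difference quotients of [G] at [x] lie between [- f x] and [- f (x + h)]. *)
Lemma is_derive_bracketed (R : realType) (G f : R -> R) (x : R) :
  (forall a b, a <= b -> (b - a) * f b <= G a - G b <= (b - a) * f a) ->
  {for x, continuous f} -> is_derive x 1 G (- f x).
Proof.
move=> Gf fx.
suff H : h^-1 *: (G (h *: 1 + x) - G x) @[h --> 0^'] --> - f x.
  apply: DeriveDef; last exact: cvg_lim H.
  by apply/cvg_ex; exists (- f x).
apply/cvgrPdist_le => e e0.
have /nbhs0P fe : \forall y \near x, `|f x - f y| <= e by exact: cvgr_dist_le fx _ e0.
near=> h.
have h0 : h != 0 by near: h; exact: nbhs_dnbhs_neq.
have : `|f x - f (x + h)| <= e by near: h; exact: cvg_within fe.
rewrite [_ *: 1]mulr1 [_ *: _]mulrC [h + x]addrC => fxh.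
have -> : - f x - (G (x + h) - G x) / h = - (f x * h + (G (x + h) - G x)) / h.
  by field.
rewrite normrM normfV normrN ler_pdivrMr ?normr_gt0//.
apply: le_trans (ler_wpM2r (normr_ge0 h) fxh).
rewrite -normrM.
(* The goal bounds the error times [h] by [|f x - f (x + h)| * |h|]; the bracket is applied to
   [x <= x + h] or to [x + h <= x] according to the sign of [h]. *)
have [hgt0|hlt0] := ltP 0 h.
  have /Gf : x <= x + h by rewrite lerDl ltW.
  rewrite [x + h]addrC addrK [h + x]addrC => /andP[? ?].
  rewrite !ger0_norm; nra.
have /Gf : x + h <= x by rewrite gerDl.
rewrite opprD addNKr => /andP[? ?].
rewrite !ger0_norm; nra.
Unshelve. all: by end_near. Qed.

(** * The expected surplus [G], its derivative and its link with [mrd] *)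

Section Surplus.
Context (d : measure_display) (T : measurableType d) (R : realType).
Context (P : probability T R) (alpha : {RV P >-> R}).

Let surplus (r : R) (w : T) : R := Num.max 0 (alpha w - r).

Definition expected_surplus (r : R) : R := fine ('E_P[surplus r])%E.

Lemma ccdf_demand_cdf (r : R) : ccdf alpha r = (1 - demand_cdf alpha r)%:E.
Proof.
by rewrite ccdf_1_cdf EFinB /demand_cdf fineK// fin_num_measure.
Qed.

Lemma demand_cdf_nondecreasing : nondecreasing_fun (demand_cdf alpha).
Proof.
by move=> a b ab; rewrite fine_le ?fin_num_measure// cdf_nondecreasing.
Qed.

Lemma measurable_surplus (r : R) : measurable_fun setT (surplus r).
Proof.
by apply: measurable_maxr => //; exact: measurable_funB.
Qed.

Lemma surplus_ge0 (r : R) (w : T) : 0 <= surplus r w.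
Proof. by rewrite le_max lexx. Qed.

Hypothesis alpha_int : P.-integrable setT (EFin \o alpha).

Lemma integrable_surplus (r : R) : P.-integrable setT (EFin \o surplus r).
Proof.
have : P.-integrable setT (fun w => (EFin \o alpha) w - r%:E)%E.
  by apply: integrableB => //; exact: finite_measure_integrable_cst.
apply: le_integrable => //; first exact/measurable_EFinP/measurable_surplus.
move=> w _ /=; rewrite lee_fin ger0_norm ?surplus_ge0//.
by rewrite /surplus ge_max normr_ge0 ler_norm.
Qed.

Lemma expected_surplusE (r : R) :
  (expected_surplus r)%:E = (\int[P]_w (surplus r w)%:E)%E.
Proof.
rewrite /expected_surplus unlock fineK//.
exact: integrable_fin_num (integrable_surplus r).
Qed.

(** Integrates the pointwise bounds on the difference of the surpluses at [a] and [b]: it is at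
    least [b - a] times the indicator of [alpha > b], and at most [b - a] times that of
    [alpha > a]. *)
Lemma expected_surplus_bracket (a b : R) : a <= b ->
  (b - a) * (1 - demand_cdf alpha b) <=
    expected_surplus a - expected_surplus b <=
  (b - a) * (1 - demand_cdf alpha a).
Proof.
move=> ab.
pose tail c := alpha @^-1` `]c, +oo[.
have mtail c : measurable (tail c) by exact: measurable_funPTI.
(* Moving the surplus at [b] to the indicator side keeps every integrand nonnegative; [c = b] serves
   the lower bound and [c = a] the upper one. *)
have tailE c :
  (\int[P]_w ((surplus b w)%:E + ((b - a)%:E * (\1_(tail c) w)%:E)) =
    (expected_surplus b + (b - a) * (1 - demand_cdf alpha c))%:E)%E.
  rewrite ge0_integralD//=; first last.
  - apply: measurable_funeM; apply/measurable_EFinP.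
    exact: measurable_indic.
  - by move=> w _; rewrite -EFinM lee_fin mulr_ge0 ?subr_ge0.
  - exact/measurable_EFinP/measurable_surplus.
  - by move=> w _; rewrite lee_fin surplus_ge0.
  rewrite ge0_integralZl//=; last 2 first.
  - by apply/measurable_EFinP; exact: measurable_indic.
  - by rewrite lee_fin subr_ge0.
  rewrite integral_indic// setIT [in RHS]EFinD expected_surplusE EFinM.
  by rewrite -ccdf_demand_cdf.
have mtailD c : measurable_fun setT
    (fun w => (surplus b w)%:E + ((b - a)%:E * (\1_(tail c) w)%:E))%E.
  apply: emeasurable_funD; first exact/measurable_EFinP/measurable_surplus.
  by apply: measurable_funeM; apply/measurable_EFinP; exact: measurable_indic.
have tailb w c : (w \in tail c) = (c < alpha w).
  by apply/idP/idP; rewrite inE /tail/= in_itv/= andbT.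
apply/andP; split.
  rewrite lerBrDl -lee_fin -tailE expected_surplusE.
  apply: ge0_le_integral => //=.
  - move=> w _; rewrite -EFinM -EFinD lee_fin addr_ge0 ?surplus_ge0//.
    by rewrite mulr_ge0 ?subr_ge0.
  - exact/measurable_EFinP/measurable_surplus.
  - move=> w _; rewrite -EFinM -EFinD lee_fin indicE tailb /surplus.
    by case: ltP => ?; rewrite /= /Num.max; do 2 case: ifP => ?; lra.
rewrite lerBlDl -lee_fin -tailE expected_surplusE.
apply: ge0_le_integral => //=.
- by move=> w _; rewrite lee_fin surplus_ge0.
- exact/measurable_EFinP/measurable_surplus.
- move=> w _; rewrite -EFinM -EFinD lee_fin indicE tailb /surplus.
  by case: ltP => ?; rewrite /= /Num.max; do 2 case: ifP => ?; lra.
Qed.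

Hypothesis F_cont : continuous (demand_cdf alpha).

Lemma is_derive_expected_surplus (r : R) :
  is_derive r 1 expected_surplus (- (1 - demand_cdf alpha r)).
Proof.
apply: (@is_derive_bracketed R _ (fun r => 1 - demand_cdf alpha r)).
  exact: expected_surplus_bracket.
by apply: continuousB; [exact: cst_continuous | exact: F_cont].
Qed.

(** By continuity [F] stays below 1 up to some [t > r], and by monotonicity [t] is a lower bound of
    the points where [F] is 1; the gap between [r] and [t] makes the inequality strict. *)
Lemma lt_demand_sup (r : R) :
  demand_cdf alpha r < 1 -> (r%:E < demand_sup alpha)%E.
Proof.
move=> Fr1.
have [t rt Ft1] : exists2 t, r < t & demand_cdf alpha t < 1.
  near r^'+ => t; exists t; near: t; first exact: nbhs_right_gt.
  by apply: cvgr_lt Fr1; apply: cvg_at_right_filter; exact: F_cont.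
apply: (@lt_le_trans _ _ t%:E); first by rewrite lte_fin.
apply: le_ereal_inf_tmp => _ [s [_ Fs1] <-]; rewrite lee_fin leNgt.
apply/negP => st; move: Ft1; rewrite ltNge -Fs1 demand_cdf_nondecreasing//.
exact: ltW.
Unshelve. all: by end_near. Qed.

(** Restricting [alpha - r] to the event [alpha > r] gives the positive part. *)
Lemma mrdE (r : R) : demand_cdf alpha r < 1 ->
  mrd alpha r = expected_surplus r / (1 - demand_cdf alpha r).
Proof.
move=> Fr1; rewrite /mrd lt_demand_sup// /cond_expectation.
have setE : [set w | r < alpha w] = alpha @^-1` `]r, +oo[.
  by apply/seteqP; split => w /=; rewrite in_itv/= andbT.
congr (_ / _); last first.
  rewrite setE; have := ccdf_demand_cdf r.
  by rewrite /ccdf /distribution /pushforward => ->.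
rewrite /expected_surplus unlock integral_mkcond; congr fine.
apply: eq_integral => w _; rewrite patchE /surplus.
have [aw|aw] := ltP r (alpha w).
  by rewrite mem_set// max_r// subr_ge0 ltW.
by rewrite memNset ?max_l ?subr_le0//=; apply/negP; rewrite -leNgt.
Qed.

End Surplus.

(** * The upper bound on the no-trade probability *)

Section NoTradeBound.
Context (d : measure_display) (T : measurableType d) (R : realType).
Context (P : probability T R) (alpha : {RV P >-> R}).
Local Notation F := (demand_cdf alpha).
Local Notation G := (expected_surplus alpha).
Hypothesis demand : demand_distribution alpha.

Lemma expected_surplus_ge0 (r : R) : 0 <= G r.
Proof. by rewrite fine_ge0// expectation_ge0// => w; rewrite le_max lexx. Qed.

(** Since [F 0 = 0] and [F] is continuous, some [t > 0] has mass above it, and [G (t / 2)] is at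
    least [(t / 2) * (1 - F t)]. This makes the optimal profit positive. *)
Lemma expected_surplus_gt0 : exists2 s, 0 < s & 0 < G s.
Proof.
have [_ Fc F0 Fint] := demand.
have [t t0 Ft1] : exists2 t, 0 < t & F t < 1.
  near (0:R)^'+ => t; exists t; near: t; first exact: nbhs_right_gt.
  apply: (cvgr_lt 0 _ 1 ltr01); apply: cvg_at_right_filter.
  by rewrite -[X in _ --> X]F0; exact: Fc.
exists (t / 2); first by rewrite divr_gt0.
have : t / 2 <= t by lra.
move/(expected_surplus_bracket Fint) => /andP[+ _].
have := expected_surplus_ge0 t.
nra.
Unshelve. all: by end_near. Qed.

(** Positive profit rules out [r = 0], so the maximum is interior and the derivative
    [G r - r * (1 - F r)] vanishes; [G r > 0] then forces [F r < 1]. *)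
Lemma optimal_price_first_order (r : R) : optimal_price alpha r ->
  [/\ 0 < r, F r < 1 & G r = r * (1 - F r)].
Proof.
have [_ Fc F0 Fint] := demand.
move=> [r0 rmax].
have [s s0 Gs0] := expected_surplus_gt0.
have profit_gt0 : 0 < r * G r.
  by apply: lt_le_trans (rmax _ (ltW s0)); rewrite mulr_gt0.
have rgt0 : 0 < r.
  rewrite lt0r r0 andbT; apply/eqP => rE.
  by move: profit_gt0; rewrite rE mul0r ltxx.
suff Gr : G r = r * (1 - F r).
  by split=> //; rewrite -subr_gt0 -(pmulr_rgt0 _ rgt0) -Gr -(pmulr_rgt0 _ rgt0).
have dG x := is_derive_expected_surplus Fint Fc x.
have dprofit (x : R) :
    is_derive x 1 ((id : R -> R) * G) (x *: - (1 - F x) + G x *: 1).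
  exact: is_deriveM.
(* The endpoint [r + 1] only serves to make [r] interior. *)
have /(@derive1_at_max _ (id * G) 0 (r + 1) r) : 0 <= r + 1 by rewrite addr_ge0.
have dr : r \in `]0, r + 1[ by rewrite in_itv/= rgt0 ltrDl ltr01.
move=> /(_ _ dr) [].
- by move=> x _; have [] := dprofit x.
- by move=> x; rewrite in_itv/= => /andP[x0 _]; exact: rmax (ltW x0).
move=> _; have [_ ->] := dprofit r.
by rewrite /GRing.scale/= => ?; lra.
Qed.

Lemma no_trade_probability_le (r : R) : DMRD alpha -> optimal_price alpha r ->
  F r <= 1 - expR (-1).
Proof.
have [_ Fc F0 Fint] := demand.
move=> dmrd ropt.
have [r0 Fr1 Gr] := optimal_price_first_order ropt.
have mrdr : mrd alpha r = r by rewrite mrdE// Gr mulfK// subr_eq0 gt_eqF.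
have Gge s : 0 <= s -> s <= r -> r * (1 - F s) <= G s.
  move=> s0 sr.
  have Fs1 : F s < 1 by apply: le_lt_trans Fr1; exact: demand_cdf_nondecreasing.
  have : r <= mrd alpha s.
    by rewrite -{1}mrdr; apply: dmrd; rewrite ?in_itv/= ?andbT// ltW.
  by rewrite mrdE// ler_pdivlMr// subr_gt0.
(* The integrating factor [expR (s / r)] replaces the logarithm of [G]: [phi] is nondecreasing on
   [[0, r]] exactly because [r * (1 - F s) <= G s] there. *)
pose phi : R -> R := G * (expR \o *%R r^-1).
have dphi (s : R) : is_derive s 1 phi
    (expR (r^-1 * s) * (r^-1 * G s - (1 - F s))).
  have dG := is_derive_expected_surplus Fint Fc s.
  have dE : is_derive s 1 (expR \o *%R r^-1) (expR (r^-1 * s) * r^-1).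
    apply: is_derive1_comp.
    change ( *%R r^-1) with (r^-1 \*: (id : R -> R)).
    by apply: is_derive_eq; exact: mulr1.
  apply: (is_derive_eq (is_deriveM dG dE)).
  rewrite /GRing.scale/=; ring.
have phi_le : phi 0 <= phi r.
  apply: (@ger0_derive1_le_cc _ phi 0 r); rewrite ?in_itv/= ?lexx ?(ltW r0)//.
  - move=> s; rewrite in_itv/= => /andP[s0 sr].
    rewrite derive1E; have [_ ->] := dphi s.
    rewrite mulr_ge0 ?expR_ge0// subr_ge0 ler_pdivlMl//.
    by rewrite Gge ?ltW.
  - by apply: derivable_within_continuous => s _; have [] := dphi s.
have G0 : r <= G 0 by have := Gge 0 (lexx _) (ltW r0); rewrite F0 subr0 mulr1.
(* Now [r <= G 0 <= r * (1 - F r) * expR 1], and [r > 0] cancels. *)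
move: phi_le; rewrite /phi !mulrfctE/= mulr0 expR0 mulr1 mulVf ?gt_eqF// Gr.
move=> /(le_trans G0); rewrite -mulrA ler_pMr// => h.
rewrite expRN lerBrDr -lerBrDl -[_^-1]mul1r ler_pdivrMr ?expR_gt0//.
Qed.

End NoTradeBound.

(** * Sharpness: demand with an exponential tail *)

Lemma integral_expRN (R : realType) :
  (\int[lebesgue_measure]_(t in `[0%R, +oo[) (expR (- t))%:E = 1 :> \bar R)%E.
Proof.
rewrite -(@integral_exponential_pdf R 1 ltr01) integral_mkcond.
apply: eq_integral => t _; rewrite /exponential_pdf !patchE.
by case: ifP => // _; rewrite mul1r mulN1r.
Qed.

Section ExponentialTail.
Context (d : measure_display) (T : measurableType d) (R : realType).
Context (P : probability T R) (alpha : {RV P >-> R}).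
Hypothesis alpha_ge0 : forall w, 0 <= alpha w.
Hypothesis expF : forall r, 0 <= r -> demand_cdf alpha r = 1 - expR (- r).

(** Layer-cake formula: the surplus exceeds [t >= 0] with probability [expR (- (r + t))], which is
    integrated over [t]. *)
Lemma expectation_surplus_exponential (r : R) : 0 <= r ->
  ('E_P[(fun w => Num.max 0 (alpha w - r))%R] = (expR (- r))%:E)%E.
Proof.
move=> r0.
pose X w := Num.max 0 (alpha w - r).
have mX : measurable_fun setT X := measurable_surplus alpha r.
pose mfX := isMeasurableFun.Build _ _ _ _ X mX.
pose Y : {RV P >-> R} := HB.pack X mfX.
have -> : ('E_P[(fun w => Num.max 0 (alpha w - r))%R] = 'E_P[Y])%E by [].
rewrite ge0_expectation_ccdf; last by move=> w; rewrite le_max lexx.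
rewrite -[RHS]mule1 -integral_expRN -ge0_integralZl//=.
- apply: eq_integral => t; rewrite inE/= in_itv/= andbT => t0.
  have -> : ccdf Y t = ccdf alpha (r + t).
    rewrite /ccdf /distribution /pushforward; congr (P _).
    apply/seteqP; split => w /=;
      by rewrite /X !in_itv/= !andbT lt_max ltNge t0/= ltrBrDl.
  by rewrite ccdf_demand_cdf expF ?addr_ge0// opprB addrC subrK opprD expRD.
- by apply: measurable_funTS; apply/measurable_EFinP; exact: measurableT_comp.
Qed.

Lemma expected_surplus_exponential (r : R) : 0 <= r ->
  expected_surplus alpha r = expR (- r).
Proof. by move=> r0; rewrite /expected_surplus expectation_surplus_exponential. Qed.

Lemma demand_distribution_exponential : demand_distribution alpha.
Proof.
have maxE w : Num.max 0 (alpha w - 0) = alpha w by rewrite subr0 max_r.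
split => //.
(* [expF] covers only [r >= 0]; for negative [r], monotonicity squeezes [F r] between 0 and
   [F 0 = 0], so a single formula with [Num.max 0 r] holds everywhere. *)
- have maxF : continuous (fun r : R => 1 - expR (- Num.max 0 r)).
    move=> r; apply: cvgB; first exact: cvg_cst.
    apply: (@cvg_comp _ _ _ (fun x : R => - Num.max 0 x) expR _
              (nbhs (- Num.max 0 r))).
      apply: cvgN; apply: (@continuous_max _ R (cst 0) id r).
        exact: cst_continuous.
      exact: cvg_id.
    exact: continuous_expR.
  rewrite (_ : demand_cdf alpha = fun r => 1 - expR (- Num.max 0 r))//.
  apply/funext => r; have [r0|r0] := leP 0 r; first exact: expF.
  rewrite oppr0 expR0 subrr.
  apply/eqP; rewrite eq_le fine_ge0 ?cdf_ge0// andbT.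
  have -> : 0 = demand_cdf alpha 0 by rewrite expF// oppr0 expR0 subrr.
  exact/demand_cdf_nondecreasing/ltW.
- by rewrite expF// oppr0 expR0 subrr.
- apply/integrableP; split; first exact/measurable_EFinP.
  rewrite (eq_integral (fun w => (Num.max 0 (alpha w - 0))%:E)).
    have := expectation_surplus_exponential (lexx 0).
    by rewrite unlock => ->; rewrite ltry.
  by move=> w _; rewrite maxE/= ger0_norm.
Qed.

Lemma mrd_exponential (r : R) : 0 <= r -> mrd alpha r = 1.
Proof.
have [_ Fc _ Fint] := demand_distribution_exponential.
move=> r0; rewrite mrdE// expF ?ltrBlDr ?ltrDl ?expR_gt0//.
rewrite expected_surplus_exponential// opprB addrC subrK divff//.
by rewrite gt_eqF ?expR_gt0.
Qed.

Lemma DMRD_exponential : DMRD alpha.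
Proof.
move=> a b; rewrite !in_itv/= !andbT => a0 b0 _.
by rewrite !mrd_exponential.
Qed.

(** The profit is [s * expR (- s)], and [s * expR (- s) <= expR (-1)] rearranges to
    [1 + (s - 1) <= expR (s - 1)]. *)
Lemma optimal_price_exponential : optimal_price alpha 1.
Proof.
split=> // s s0.
have -> : supplier_profit alpha s = s * expected_surplus alpha s by [].
have -> : supplier_profit alpha 1 = 1 * expected_surplus alpha 1 by [].
rewrite !expected_surplus_exponential// mul1r.
rewrite -ler_pdivlMr ?expR_gt0// -expRN opprK -expRD.
by have := expR_ge1Dx (- 1 + s); lra.
Qed.

End ExponentialTail.

(** * A concrete demand with the exponential law of rate 1 *)

Section ExponentialDemand.
Context (R : realType).

(* [exponential_prob 1] with its probability structure, whose canonical instance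
   takes the positivity of the rate as an argument that unification cannot
   infer. *)
Definition exponential1 : probability (measurableTypeR R) R :=
  exponential_distribution_exponential_prob__canonical__probability_measure_Probability
     (@ltr01 R).
(** The identity is nonnegative only almost surely under this law, whereas [demand_distribution]
    asks for nonnegativity at every outcome. *)
Definition pos_part : measurableTypeR R -> R := Num.max 0.

Lemma measurable_pos_part : measurable_fun setT pos_part.
Proof. exact: measurable_maxr. Qed.

HB.instance Definition _ :=
  isMeasurableFun.Build _ _ _ _ pos_part measurable_pos_part.

Lemma demand_cdf_pos_part (r : R) : 0 <= r ->
  demand_cdf (pos_part : {RV exponential1 >-> R}) r = 1 - expR (- r).
Proof.
move=> r0.
(* The two events differ only on the negative half-line, where the density vanishes. *)
have E : exponential1 (pos_part @^-1` `]-oo, r]) = exponential_prob 1 `[0, r].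
  rewrite /exponential1/= /exponential_prob integral_mkcond [RHS]integral_mkcond.
  apply: eq_integral => x _; rewrite !patchE.
  have [x0|x0] := ltP x 0.
    by rewrite lt0_exponential_pdf// !if_same.
  congr (if _ then _ else _); rewrite -[LHS]/(_ \in _).
  by apply/idP/idP; rewrite !inE /pos_part/= !in_itv/= max_r// x0.
rewrite /demand_cdf /cdf /distribution /pushforward E.
have [rgt0|rle0] := ltP 0 r; first by rewrite exponential_prob_itv0c// mulN1r.
have -> : r = 0 by apply/eqP; rewrite eq_le rle0.
by rewrite set_itv1 /exponential_prob integral_set1 oppr0 expR0 subrr.
Qed.

End ExponentialDemand.

Theorem theorem5p1 (R : realType) :
  (forall (d : measure_display) (T : measurableType d) (P : probability T R)
      (alpha : {RV P >-> R}) (r : R),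
    demand_distribution alpha -> DMRD alpha -> optimal_price alpha r ->
    demand_cdf alpha r <= 1 - expR (-1))
  /\
  (forall c : R, c < 1 - expR (-1) ->
    ~ (forall (d : measure_display) (T : measurableType d)
          (P : probability T R) (alpha : {RV P >-> R}) (r : R),
        demand_distribution alpha -> DMRD alpha -> optimal_price alpha r ->
        demand_cdf alpha r <= c)).
Proof.
split.
  by move=> d T P alpha r demand; exact: no_trade_probability_le.
(* At the optimal price 1, exponential demand has no-trade probability exactly [1 - expR (-1)],
   which exceeds [c]. *)
move=> c cE /(_ _ _ (exponential1 R) (@pos_part R) 1).
have pos_ge0 w : 0 <= @pos_part R w by rewrite le_max lexx.
move=> /(_ (demand_distribution_exponential pos_ge0 (@demand_cdf_pos_part R))).
move=> /(_ (DMRD_exponential pos_ge0 (@demand_cdf_pos_part R))).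
move=> /(_ (optimal_price_exponential (@demand_cdf_pos_part R))).
by rewrite demand_cdf_pos_part ?ler01// leNgt cE.
Qed.
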